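(* Let $n$ be a nonnegative integer and let $\Omega$ be the set of perfect matchings of the complete graph $K_{2n}$. Let $t\in\{0,\ldots,n\}$, let $D\subseteq\Omega$ be a $t$-design of index $\lambda$ in the perfect matching semilattice, and let $M$ be a (not necessarily perfect) matching of $K_{2n}$. For $s\in\{0,\ldots,t\}$ let $\lambda_s$ be the index of $D$ as an $s$-design. Then the following systems of equations hold, and they are equivalent. (a) (Mendelsohn equations) For all $r\in\{0,\ldots,t\}$, $$\sum_{s=r}^n\binom{s}{r}\alpha_s(M)=\binom{\#M}{r}\lambda_r.$$ The right-hand side admits the alternative expressions $$\binom{\#M}{r}\lambda_r=\binom{\#M}{r}\frac{(2(n-r)-1)!!}{(2(n-t)-1)!!}\lambda=\binom{\#M}{r}\frac{(2(n-r)-1)!!}{(2n-1)!!}\#D.$$ (b) (K\''ohler parametrization) For all $r\in\{0,\ldots,t\}$, $$\alpha_r(M)=\binom{\#M}{r}\sum_{s=0}^{t-r}(-1)^s\binom{\#M-r}{s}\lambda_{r+s}-\sum_{u=t+1}^n\binom{u}{r}\left(\sum_{s=0}^{t-r}(-1)^s\binom{u-r}{s}\right)\alpha_u(M),$$ where the inner sum on the right-hand side admits the alternative form $$\sum_{s=0}^{t-r}(-1)^s\binom{u-r}{s}=-\sum_{s=t+1-r}^{u-r}(-1)^s\binom{u-r}{s}.$$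
   Context: $K_{2n}$ is the complete graph on $2n$ vertices. A matching is a set of pairwise disjoint edges; a matching $M$ of $K_{2n}$ is perfect if $\#M=n$. The perfect matching semilattice is the set of all matchings of $K_{2n}$ ordered by inclusion; its meet is intersection, the height of $M$ is $\#M$, and its top level is the set $\Omega$ of perfect matchings. A subset $D\subseteq\Omega$ is a $t$-design of index $\lambda$ if every matching of $K_{2n}$ with exactly $t$ edges is contained in exactly $\lambda$ elements of $D$. It is a known fact that a $t$-design of index $\lambda$ is also an $s$-design for every $s\in\{0,\ldots,t\}$, with index $\lambda_s=\frac{(2(n-s)-1)!!}{(2(n-t)-1)!!}\lambda$. For $s\in\{0,\ldots,n\}$, $\alpha_s(M)=\#\{M'\in D:\#(M\cap M')=s\}$. For $k\ge 1$, $(2k-1)!!=1\cdot 3\cdot 5\cdots(2k-1)$, and for $k=0$, $(2k-1)!!=1$. (When $\#M<r$, the factor $\binom{\#M}{r}$ is zero and the term containing $\binom{\#M-r}{s}$ is read as zero.) *)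

(* Defs.v *)
From mathcomp Require Import all_boot all_order all_algebra.
Set Implicit Arguments.
Unset Strict Implicit.
Unset Printing Implicit Defensive.
Import Order.TTheory GRing.Theory Num.Theory.
Local Open Scope ring_scope.

(* The vertices of K_{2n} are 'I_(2 * n); its edges are the two-element sets
   of vertices, so a matching is a set of such sets. *)
Definition is_matching (n : nat) (M : {set {set 'I_(2 * n)}}) : bool :=
  [forall e in M, #|e| == 2%N] && trivIset M.

Definition perfect_matchings (n : nat) : {set {set {set 'I_(2 * n)}}} :=
  [set M | is_matching M & #|M| == n].

Definition is_design (n : nat) (D : {set {set {set 'I_(2 * n)}}})
    (t lam : nat) : bool :=
  (D \subset perfect_matchings n) &&
  [forall T : {set {set 'I_(2 * n)}}, is_matching T && (#|T| == t) ==>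
     (#|[set B in D | T \subset B]| == lam)].

(* The index of D as an s-design (0 if D is not one). For s <= n it is unique,
   since K_{2n} has matchings with s edges, and it is at most #|D|. *)
Definition design_index (n : nat) (D : {set {set {set 'I_(2 * n)}}})
    (s : nat) : nat :=
  if [pick l : 'I_#|D|.+1 | is_design D s l] is Some l then l : nat else 0%N.

Definition alpha (n : nat) (D : {set {set {set 'I_(2 * n)}}})
    (M : {set {set 'I_(2 * n)}}) (s : nat) : nat :=
  #|[set B in D | #|M :&: B| == s]|.

(* odd_dfact k = (2k-1)!! *)
Definition odd_dfact (k : nat) : nat := (\prod_(i < k) (2 * i + 1))%N.

(* Both systems are linear systems in unknowns a_0, ..., a_n; here m is the
   size of the matching M and lam s is the index as an s-design. *)
Definition mendelsohn_system (n t m : nat) (lam : nat -> nat)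
    (a : nat -> rat) : Prop :=
  forall r : nat, (r <= t)%N ->
    \sum_(r <= s < n.+1) 'C(s, r)%:R * a s = 'C(m, r)%:R * (lam r)%:R.

(* The subtraction in 'C(m - r, s) is truncated; this is harmless, as
   'C(m, r) = 0 for m < r. *)
Definition koehler_system (n t m : nat) (lam : nat -> nat)
    (a : nat -> rat) : Prop :=
  forall r : nat, (r <= t)%N ->
    a r = 'C(m, r)%:R *
            (\sum_(0 <= s < (t - r).+1)
               (-1) ^+ s * 'C(m - r, s)%:R * (lam (r + s)%N)%:R)
          - \sum_(t.+1 <= u < n.+1)
              'C(u, r)%:R *
              (\sum_(0 <= s < (t - r).+1) (-1) ^+ s * 'C(u - r, s)%:R) * a u.

(* Main.v *)
Require Import Defs.
From mathcomp Require Import all_boot all_order all_algebra.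
From mathcomp Require Import ring zify.
Set Implicit Arguments.
Unset Strict Implicit.
Unset Printing Implicit Defensive.
Import Order.TTheory GRing.Theory Num.Theory.
Local Open Scope ring_scope.

(** The proof has a combinatorial half and a linear-algebra half.

    Combinatorics.  The Mendelsohn equation for r is a double count of the
    pairs (T, B) with T an r-subset of M and B a member of D containing T:
    grouping by B, with s the size of M :&: B, gives the left-hand side, and
    grouping by T gives the right-hand side, because every T is a matching
    and so lies in lambda_r members of D ([mendelsohn_count]).  That D is an
    r-design for every r <= t, with the stated index, comes from stepping down
    one edge at a time ([design_pred]): fix a vertex v off a matching T with
    t edges; a perfect matching containing T covers v by exactly one edge
    [set v; w], with w one of the 2(n - t) - 1 other vertices off T, and
    T together with that edge is a matching with t + 1 edges.

    Linear algebra.  Moving the terms with index u > t to the right-hand side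
    turns the Mendelsohn system into
      sum_(s <= t) C(s, r) a_s = c_r   for r <= t,
      where c_r = C(m, r) lambda_r - sum_(u > t) C(u, r) a_u.
    The Pascal matrix (C(s, r)) truncated at t is triangular with inverse
    ((-1)^(r + s) C(s, r)) ([binomial_inversion]), so the system is equivalent
    to a_r = sum_(j <= t) (-1)^(r + j) C(j, r) c_j.  Writing j = r + s and
    using C(k, r + s) C(r + s, r) = C(k, r) C(k - r, s), for k = m and for
    k = u, turns this into the Koehler system ([mendelsohn_koehler]). *)

(** * Binomial identities and inversion *)

(** Both sides count pairs of disjoint subsets of sizes r and s in an m-set.
    The truncated subtraction does no harm: when m < r both sides vanish. *)
Lemma trinomial_revision (m r s : nat) :
  ('C(m, r + s) * 'C(r + s, r) = 'C(m, r) * 'C(m - r, s))%N.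
Proof.
have [le_m | lt_m] := leqP (r + s) m; last first.
  rewrite (bin_small lt_m) mul0n.
  have [lt_mr | le_rm] := ltnP m r; first by rewrite bin_small.
  by rewrite ['C(m - r, s)]bin_small ?muln0 // ltn_subLR.
have le_rm : (r <= m)%N := leq_trans (leq_addr s r) le_m.
have le_s : (s <= m - r)%N by rewrite leq_subRL.
have fact_gt : (0 < r`! * s`! * (m - (r + s))`!)%N by rewrite !muln_gt0 !fact_gt0.
apply/eqP; rewrite -(eqn_pmul2r fact_gt); apply/eqP.
have E1 := bin_fact le_m; have E2 := bin_fact (leq_addr s r).
have E3 := bin_fact le_rm; have E4 := bin_fact le_s.
rewrite addKn in E2; rewrite subnDA in E1 *.
transitivity (m`!); first by rewrite -E1 -E2; ring.
by rewrite -E3 -E4; ring.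
Qed.

(** Binomial expansion of (1 - 1)^k. *)
Lemma sum_alternating_bin (R : comPzRingType) (k : nat) :
  \sum_(0 <= s < k.+1) (-1) ^+ s * 'C(k, s)%:R = (k == 0)%:R :> R.
Proof.
rewrite big_mkord -expr0n -[in RHS](subrr 1) exprBn.
by apply: eq_bigr => i _; rewrite !expr1n !mulr1 mulr_natr.
Qed.

(** The terms with j < r vanish, and the sign (-1)^(r + j) equals (-1)^(j - r).
    The left-hand form, summed over a range that does not depend on r, is the
    one in which two sums can be exchanged; the right-hand form is the one that
    occurs in the Koehler parametrization. *)
Lemma sum_shift_bin (R : pzRingType) (r t : nat) (x : nat -> R) : (r <= t)%N ->
  \sum_(0 <= j < t.+1) (-1) ^+ (r + j) * 'C(j, r)%:R * x j
  = \sum_(0 <= s < (t - r).+1) (-1) ^+ s * 'C(r + s, r)%:R * x (r + s)%N.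
Proof.
move=> le_rt; rewrite (big_cat_nat (leq0n r)) ?(leqW le_rt) //=.
rewrite big_nat_cond big1 ?add0r => [|j /andP[/andP[_ lt_jr] _]]; last first.
  by rewrite bin_small // mulr0 mul0r.
rewrite -{1}[r]add0n big_addn subSn //; apply: eq_bigr => s _.
rewrite [(s + r)%N]addnC addnA [(-1) ^+ _]exprD -signr_odd addnn odd_double.
by rewrite expr0 mul1r.
Qed.

(** Orthogonality of the truncated Pascal matrix and its signed version:
    trinomial revision pulls out C(s, r) and leaves the expansion of
    (1 - 1)^(s - r). *)
Lemma sum_bin_bin (R : comPzRingType) (r s t : nat) :
    (r <= t)%N -> (s <= t)%N ->
  \sum_(0 <= j < t.+1) (-1) ^+ (r + j) * 'C(j, r)%:R * 'C(s, j)%:R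
  = (s == r)%:R :> R.
Proof.
move=> le_rt le_st; rewrite sum_shift_bin //.
under eq_bigr => i _ do
  rewrite -mulrA -natrM [('C(_, r) * _)%N]mulnC trinomial_revision natrM mulrCA.
rewrite -mulr_sumr.
have [lt_sr | le_rs] := ltnP s r.
  by rewrite bin_small // mul0r (ltn_eqF lt_sr).
rewrite (big_cat_nat (leq0n (s - r).+1)) ?ltnS ?leq_sub2r //= sum_alternating_bin.
rewrite big_nat_cond big1 ?addr0 => [|j /andP[/andP[lt_j _] _]]; last first.
  by rewrite ['C(s - r, j)]bin_small // mulr0.
rewrite subn_eq0; case: (eqVneq s r) => [->|ne_sr]; first by rewrite binn leqnn mulr1.
by rewrite leqNgt ltn_neqAle eq_sym ne_sr le_rs mulr0.
Qed.

(** Both directions use the same orthogonality relation, since the inverse of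
    the Pascal matrix is its conjugate by the diagonal matrix of the signs. *)
Lemma binomial_inversion (R : comPzRingType) (t : nat) (a c : nat -> R) :
  (forall r, (r <= t)%N -> \sum_(0 <= s < t.+1) 'C(s, r)%:R * a s = c r) <->
  (forall r, (r <= t)%N ->
     a r = \sum_(0 <= j < t.+1) (-1) ^+ (r + j) * 'C(j, r)%:R * c j).
Proof.
have sum_delta r (x : nat -> R) : (r <= t)%N ->
    \sum_(0 <= s < t.+1) (s == r)%:R * x s = x r.
  move=> le_rt; rewrite (bigD1_seq r) ?mem_index_iota ?iota_uniq //= eqxx mul1r.
  by rewrite big1 ?addr0 // => s /negPf->; rewrite mul0r.
split=> E r le_rt.
  rewrite -[LHS]sum_delta //.
  transitivity (\sum_(0 <= s < t.+1) \sum_(0 <= j < t.+1)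
      (-1) ^+ (r + j) * 'C(j, r)%:R * 'C(s, j)%:R * a s).
    by apply: eq_big_nat => s /andP[_ lt_s]; rewrite -mulr_suml sum_bin_bin.
  rewrite exchange_big /=; apply: eq_big_nat => j /andP[_ lt_j].
  by rewrite -E // mulr_sumr; apply: eq_bigr => s _; rewrite mulrA.
rewrite -[RHS]sum_delta //.
transitivity (\sum_(0 <= s < t.+1) \sum_(0 <= j < t.+1)
    (-1) ^+ (r + s) * 'C(s, r)%:R * 'C(j, s)%:R * ((-1) ^+ (r + j) * c j)).
  apply: eq_big_nat => s /andP[_ lt_s]; rewrite E // mulr_sumr.
  apply: eq_bigr => j _.
  have sgn2 : (-1) ^+ r * (-1) ^+ r = 1 :> R by rewrite -exprMn mulrNN mulr1 expr1n.
  (* The right-hand side carries the sign (-1)^r twice. *)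
  rewrite !exprD; set x := (-1) ^+ r in sgn2 *.
  rewrite -[LHS]mul1r -sgn2; ring.
rewrite exchange_big /=; apply: eq_big_nat => j /andP[_ lt_j].
rewrite -mulr_suml sum_bin_bin //; case: (eqVneq j r) => [->|]; last by rewrite !mul0r.
by rewrite !mul1r -signr_odd addnn odd_double expr0 mul1r.
Qed.

(** * Equivalence of the two systems *)

(** For c_r = C(m, r) lam_r - sum_(u > t) C(u, r) a_u, the two systems are the
    two sides of [binomial_inversion]; [trinomial_revision] then factors
    C(m, r) and C(u, r) out of the inverted sums. *)
Lemma mendelsohn_koehler (n t m : nat) (lam : nat -> nat) (a : nat -> rat) :
  (t <= n)%N -> mendelsohn_system n t m lam a <-> koehler_system n t m lam a.
Proof.
move=> le_tn.
pose c r : rat := 'C(m, r)%:R * (lam r)%:R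
            - \sum_(t.+1 <= u < n.+1) 'C(u, r)%:R * a u.
have := binomial_inversion t a c; set P := (X in X <-> _); set Q := (X in _ <-> X).
move=> PQ; suff [MP KQ] : (mendelsohn_system n t m lam a <-> P)
                       /\ (koehler_system n t m lam a <-> Q).
  by rewrite MP PQ KQ.
split.
  have eqE r : (r <= t)%N -> \sum_(r <= s < n.+1) 'C(s, r)%:R * a s =
      \sum_(0 <= s < t.+1) 'C(s, r)%:R * a s
      + \sum_(t.+1 <= u < n.+1) 'C(u, r)%:R * a u.
    move=> le_rt; rewrite -big_cat_nat //=.
    rewrite [RHS](@big_cat_nat _ _ _ r) ?leqW ?(leq_trans le_rt) //=.
    rewrite [X in _ = X + _]big_nat_cond [X in _ = X + _]big1 ?add0r // => s /andP[/andP[_ lt_s] _].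
    by rewrite bin_small // mul0r.
  split=> E r le_rt; have := E r le_rt; rewrite eqE //.
    by rewrite /c => <-; rewrite addrK.
  by move=> ->; rewrite subrK.
have eqE r : (r <= t)%N ->
   \sum_(0 <= j < t.+1) (-1) ^+ (r + j) * 'C(j, r)%:R * c j =
   'C(m, r)%:R *
            (\sum_(0 <= s < (t - r).+1)
               (-1) ^+ s * 'C(m - r, s)%:R * (lam (r + s)%N)%:R)
          - \sum_(t.+1 <= u < n.+1)
              'C(u, r)%:R *
              (\sum_(0 <= s < (t - r).+1) (-1) ^+ s * 'C(u - r, s)%:R) * a u.
  move=> le_rt; rewrite sum_shift_bin // mulr_sumr.
  under [X in _ = _ - X]eq_bigr => u _ do rewrite mulr_sumr mulr_suml.
  rewrite exchange_big -sumrB /=; apply: eq_bigr => s _.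
  have trinomialR k (x : rat) :
      (-1) ^+ s * 'C(r + s, r)%:R * ('C(k, r + s)%:R * x)
      = 'C(k, r)%:R * ((-1) ^+ s * 'C(k - r, s)%:R) * x.
    have : 'C(k, r + s)%:R * 'C(r + s, r)%:R = 'C(k, r)%:R * 'C(k - r, s)%:R :> rat.
      by rewrite -!natrM trinomial_revision.
    by move=> E; rewrite [in RHS]mulrCA -E; ring.
  rewrite /c mulrBr mulr_sumr trinomialR; congr (_ - _); first by rewrite !mulrA.
  by apply: eq_bigr => u _; rewrite trinomialR.
by split=> E r le_rt; rewrite (E r le_rt) eqE.
Qed.

(** The full alternating sum over a row k > 0 vanishes. *)
Lemma sum_alternating_bin_tail (R : comPzRingType) (k l : nat) : (l < k)%N ->
  \sum_(0 <= s < l.+1) (-1) ^+ s * 'C(k, s)%:R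
  = - \sum_(l.+1 <= s < k.+1) (-1) ^+ s * 'C(k, s)%:R :> R.
Proof.
move=> lt_lk; apply/eqP; rewrite -addr_eq0 -big_cat_nat ?ltnS ?(ltnW lt_lk) //.
by rewrite sum_alternating_bin; case: k lt_lk.
Qed.

(** * Matchings of the complete graph *)

Lemma is_matchingP (n : nat) (M : {set {set 'I_(2 * n)}}) :
  reflect ({in M, forall e : {set 'I_(2 * n)}, #|e| = 2%N} /\ trivIset M) (is_matching M).
Proof.
apply: (iffP andP) => -[M2 tM]; split=> //.
  by move=> e eM; apply/eqP; exact: (forall_inP M2).
by apply/forall_inP => e eM; apply/eqP; exact: M2.
Qed.

Lemma sub_matching (n : nat) (T M : {set {set 'I_(2 * n)}}) :
  T \subset M -> is_matching M -> is_matching T.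
Proof.
move=> sTM /is_matchingP[M2 tM]; apply/is_matchingP; split.
  by move=> e eT; apply: M2; exact: subsetP eT.
exact: trivIsetS tM.
Qed.

Lemma card_cover_matching (n : nat) (M : {set {set 'I_(2 * n)}}) :
  is_matching M -> #|cover M| = (#|M| * 2)%N.
Proof.
case/is_matchingP=> M2 tM; apply: (card_uniform_partition M2).
rewrite /partition eqxx tM /=; apply/negP => /M2.
by rewrite cards0.
Qed.

Lemma card_uncovered (n : nat) (M : {set {set 'I_(2 * n)}}) :
  is_matching M -> #|~: cover M| = ((n - #|M|) * 2)%N.
Proof.
move=> hM; have := cardsC (cover M); rewrite card_cover_matching // card_ord.
by lia.
Qed.

Lemma matching_setU1 (n : nat) (M : {set {set 'I_(2 * n)}}) (v w : 'I_(2 * n)) :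
    is_matching M -> v \notin cover M -> w \notin cover M -> v != w ->
  is_matching ([set v; w] |: M) /\ #|[set v; w] |: M| = #|M|.+1.
Proof.
move=> /is_matchingP[M2 tM] vM wM ne_vw.
have disj : {in M, forall e : {set _}, [disjoint [set v; w] & e]}.
  move=> e eM; rewrite -setI_eq0; apply/eqP/setP => x; rewrite !inE.
  apply: contraNF vM => /andP[/orP[]/eqP-> xe]; first by apply/bigcupP; exists e.
  by case/negP: wM; apply/bigcupP; exists e.
have M0 : set0 \notin M by apply/negP => /M2; rewrite cards0.
have [tU vwM] := trivIsetU1 disj tM M0.
split; last by rewrite cardsU1 vwM.
apply/is_matchingP; split=> // e /setU1P[->|eM]; last exact: M2.
by rewrite cards2 ne_vw.
Qed.

(** Existence makes the index of an s-design unique for s <= n: without a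
    matching with s edges, every number would be an index. *)
Lemma exists_matching (n s : nat) : (s <= n)%N ->
  exists2 T : {set {set 'I_(2 * n)}}, is_matching T & #|T| = s.
Proof.
elim: s => [|s IHs] le_sn.
  exists set0; rewrite ?cards0 //; apply/is_matchingP; split=> [e|].
    by rewrite inE.
  by apply/trivIsetP => e; rewrite inE.
have [T hT Ts] := IHs (ltnW le_sn).
have /card_gt1P[v [w [vT wT ne_vw]]] : (1 < #|~: cover T|)%N.
  by rewrite card_uncovered // Ts; lia.
rewrite !inE in vT wT; have [hU cU] := matching_setU1 hT vT wT ne_vw.
by exists ([set v; w] |: T); rewrite // cU Ts.
Qed.

(** A perfect matching covers all vertices, so B has exactly one edge [set v; w]
    at v; the vertex w avoids T because an edge of T through w would be an
    edge of B meeting [set v; w], hence equal to it, and would cover v. *)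
Lemma perfect_edge_unique (n : nat) (B T : {set {set 'I_(2 * n)}})
    (v : 'I_(2 * n)) :
    B \in perfect_matchings n -> T \subset B -> v \notin cover T ->
  #|[set w in ~: cover T :\ v | [set v; w] \in B]| = 1%N.
Proof.
rewrite inE => /andP[hB /eqP cB] sTB vT.
have [B2 tB] := is_matchingP _ hB.
have vB : v \in cover B.
  suff /setP/(_ v) : ~: cover B = set0 by rewrite !inE => /negbFE.
  by apply/eqP; rewrite -cards_eq0 card_uncovered // cB subnn.
have edge_v (e : {set 'I_(2 * n)}) : e \in B -> v \in e -> e = pblock B v.
  by move=> eB ve; rewrite (def_pblock tB eB ve).
have eB : pblock B v \in B by rewrite pblock_mem.
have ve : v \in pblock B v by rewrite mem_pblock.
have [w ne_wv def_e] : exists2 w, w != v & pblock B v = [set v; w].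
  have /eqP/cards2P[x [y [ne_xy def_e]]] := B2 _ eB.
  move: ve; rewrite def_e !inE => /orP[]/eqP->; first by exists y; rewrite // eq_sym.
  by exists x; rewrite // setUC.
apply/eqP/cards1P; exists w; apply/setP=> x; rewrite !inE.
apply/andP/eqP => [[/andP[ne_xv _] xB]| ->].
  have := edge_v _ xB (set21 v x); rewrite def_e => /setP/(_ x).
  by rewrite !inE eqxx orbT (negPf ne_xv) => /esym/eqP.
rewrite -def_e eB ne_wv; split=> //=; apply/negP => /bigcupP[f fT wf].
case/negP: vT; apply/bigcupP; exists f => //.
have fB := subsetP sTB _ fT.
by rewrite -(def_pblock tB fB wf) (def_pblock tB eB) // def_e set22.
Qed.

(** * Designs and their indices *)

Lemma is_designP (n : nat) (D : {set {set {set 'I_(2 * n)}}}) (t lam : nat) :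
  reflect (D \subset perfect_matchings n /\
           forall T, is_matching T -> #|T| = t ->
             #|[set B in D | T \subset B]| = lam)
          (is_design D t lam).
Proof.
apply: (iffP andP) => -[sD E]; split=> //.
  by move=> T hT cT; apply/eqP; move/forallP/(_ T): E; rewrite hT cT eqxx.
by apply/forallP => T; apply/implyP => /andP[hT /eqP cT]; rewrite E.
Qed.

(** The members of D containing T are sorted by the edge [set v; w] covering a
    fixed vertex v off T; each of the 2(n - t) - 1 choices of w yields lam of
    them. The factor is written 2(n - t.+1) + 1 to match the recursion of the
    odd double factorial. *)
Lemma design_pred (n : nat) (D : {set {set {set 'I_(2 * n)}}}) (t lam : nat) :
    (t < n)%N -> is_design D t.+1 lam ->
  is_design D t ((2 * (n - t.+1) + 1) * lam).
Proof.
move=> lt_tn /is_designP[sD desD]; apply/is_designP; split=> // T hT cT.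
have /card_gt0P[v] : (0 < #|~: cover T|)%N.
  by rewrite card_uncovered // cT; lia.
move=> vT; have vT' : v \notin cover T by rewrite inE in vT.
have card_w : #|~: cover T :\ v| = (2 * (n - t.+1) + 1)%N.
  have := cardsD1 v (~: cover T); rewrite vT card_uncovered // cT; lia.
rewrite -card_w -sum_nat_const.
transitivity (\sum_(B in [set B in D | T \subset B])
                \sum_(w in ~: cover T :\ v | [set v; w] \in B) 1)%N.
  rewrite -sum1_card; apply: eq_bigr => B; rewrite inE => /andP[BD sTB].
  by rewrite sum1dep_card perfect_edge_unique // (subsetP sD).
rewrite (exchange_big_dep (mem (~: cover T :\ v))) /=; last by move=> B w _ /andP[].
apply: eq_bigr => w; rewrite !inE => /andP[ne_wv wT].
have ne_vw : v != w by rewrite eq_sym.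
have [hU cU] := matching_setU1 hT vT' wT ne_vw.
rewrite -(desD _ hU) ?cU ?cT // sum1dep_card; congr #|pred_of_set _|.
apply/setP=> B; rewrite !inE subUset sub1set ne_wv wT /=.
by rewrite -andbA [(T \subset B) && _]andbC.
Qed.

Lemma odd_dfactS (k : nat) : odd_dfact k.+1 = (odd_dfact k * (2 * k + 1))%N.
Proof. by rewrite /odd_dfact big_ord_recr. Qed.

Lemma odd_dfact_gt0 (k : nat) : (0 < odd_dfact k)%N.
Proof.
elim: k => [|k IHk]; first by rewrite /odd_dfact big_ord0.
by rewrite odd_dfactS muln_gt0 IHk addn1.
Qed.

(** Iteration of [design_pred]; the relation between the indices is kept
    multiplicative so as to stay in the natural numbers. *)
Lemma design_le (n : nat) (D : {set {set {set 'I_(2 * n)}}}) (s t lam : nat) :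
    (s <= t)%N -> (t <= n)%N -> is_design D t lam ->
  exists2 l, is_design D s l &
    (l * odd_dfact (n - t) = odd_dfact (n - s) * lam)%N.
Proof.
move=> le_st; rewrite -(subnKC le_st); move: (t - s)%N => d {t le_st}.
elim: d lam => [|d IHd] lam le_n desD.
  by rewrite addn0 in desD *; exists lam; rewrite // mulnC.
rewrite addnS in le_n desD *.
have [l desl El] := IHd _ (ltnW le_n) (design_pred le_n desD).
exists l => //; move: El.
rewrite -(subnSK le_n) odd_dfactS; set k := (n - _)%N => El.
apply/eqP; rewrite -(@eqn_pmul2r (2 * k + 1)); last by rewrite addn1.
by rewrite -mulnA El mulnA mulnAC.
Qed.

Lemma design_indexE (n : nat) (D : {set {set {set 'I_(2 * n)}}}) (s l : nat) :
  (s <= n)%N -> is_design D s l -> design_index D s = l.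
Proof.
move=> le_sn /[dup] hl /is_designP[_ desl].
have [T hT cT] := exists_matching le_sn.
have lt_l : (l < #|D|.+1)%N.
  by rewrite ltnS -(desl T hT cT) subset_leq_card //; apply/subsetP => B /setIdP[].
rewrite /design_index; case: pickP => [k /is_designP[_ desk] | /(_ (Ordinal lt_l))].
  by rewrite -(desl T hT cT) (desk T hT cT).
by rewrite hl.
Qed.

Lemma design0_index (n : nat) (D : {set {set {set 'I_(2 * n)}}}) (l : nat) :
  is_design D 0 l -> l = #|D|.
Proof.
case/is_designP=> _ des0; have [T hT cT] := exists_matching (leq0n n).
rewrite -(des0 T hT cT); have /eqP-> : T == set0 by rewrite -cards_eq0 cT.
by apply: eq_card => B; rewrite inE sub0set andbT.
Qed.

(** * Double counting *)

(** The incidences counted are the pairs (T, B) with B in D and T an r-subset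
    of M :&: B; there are C(#|M :&: B|, r) of them for each B and l for each
    r-subset T of M. *)
Lemma mendelsohn_count (n : nat) (D : {set {set {set 'I_(2 * n)}}})
    (M : {set {set 'I_(2 * n)}}) (r l : nat) :
    is_matching M -> is_design D r l ->
  (\sum_(r <= s < n.+1) 'C(s, r) * alpha D M s = 'C(#|M|, r) * l)%N.
Proof.
move=> hM /is_designP[sD desD].
transitivity (\sum_(B in D) 'C(#|M :&: B|, r))%N.
  have card_MB B : B \in D -> (#|M :&: B| < n.+1)%N.
    move/(subsetP sD); rewrite inE => /andP[_ /eqP cB].
    by rewrite ltnS -[leqRHS]cB subset_leq_card // subsetIr.
  transitivity (\sum_(0 <= s < n.+1) 'C(s, r) * alpha D M s)%N.
    have [le_r | lt_r] := leqP r n.+1.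
      rewrite [RHS](big_cat_nat (leq0n r)) //= [X in (X + _)%N]big_nat_cond.
      rewrite [X in (_ = X + _)%N]big1 ?add0n // => s /andP[/andP[_ lt_s] _].
      by rewrite bin_small.
    rewrite big_geq ?(ltnW lt_r) // big_nat_cond big1 // => s /andP[/andP[_ lt_s] _].
    by rewrite bin_small // (leq_trans lt_s) // ltnW.
  rewrite big_mkord.
  transitivity (\sum_(s < n.+1) \sum_(B in [set B in D | #|M :&: B| == s])
                  'C(s, r))%N.
    by apply: eq_bigr => s _; rewrite sum_nat_const mulnC.
  rewrite (exchange_big_dep (mem D)) /=; last by move=> s B _ /setIdP[].
  apply: eq_bigr => B BD; rewrite (big_pred1 (Ordinal (card_MB B BD))) // => s.
  by rewrite inE BD; exact: eq_sym.
transitivity (\sum_(B in D)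
                \sum_(T in [set T : {set {set 'I_(2 * n)}} | T \subset M & #|T| == r]
                       | T \subset B) 1)%N.
  apply: eq_bigr => B _; rewrite -cards_draws sum1dep_card.
  congr #|pred_of_set _|; apply/setP=> T; rewrite !inE subsetI.
  by rewrite -!andbA [(T \subset B) && _]andbC.
rewrite (exchange_big_dep (mem [set T : {set {set _}} | T \subset M & #|T| == r])) /=; last first.
  by move=> B T _ /andP[].
rewrite -(cards_draws M r) -sum_nat_const; apply: eq_bigr => T.
rewrite inE => /andP[sTM /eqP cT].
rewrite -(desD T (sub_matching sTM hM) cT) sum1dep_card.
by congr #|pred_of_set _|; apply/setP=> B; rewrite !inE sTM cT eqxx.
Qed.

(** * Mendelsohn equations and Koehler parametrization of a design *)

Theorem corollary7 (n t lam : nat) (D : {set {set {set 'I_(2 * n)}}})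
    (M : {set {set 'I_(2 * n)}})
    (ht : (t <= n)%N) (hD : is_design D t lam) (hM : is_matching M) :
  [/\ mendelsohn_system n t #|M| (design_index D)
        (fun s => (alpha D M s)%:R),
      forall r : nat, (r <= t)%N ->
        'C(#|M|, r)%:R * (design_index D r)%:R
          = 'C(#|M|, r)%:R
            * ((odd_dfact (n - r))%:R / (odd_dfact (n - t))%:R) * lam%:R :> rat
        /\ 'C(#|M|, r)%:R * (design_index D r)%:R
          = 'C(#|M|, r)%:R
            * ((odd_dfact (n - r))%:R / (odd_dfact n)%:R) * #|D|%:R :> rat,
      koehler_system n t #|M| (design_index D)
        (fun s => (alpha D M s)%:R),
      forall r u : nat, (r <= t)%N -> (t < u <= n)%N ->
        \sum_(0 <= s < (t - r).+1) (-1) ^+ s * 'C(u - r, s)%:R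
          = - \sum_(t.+1 - r <= s < (u - r).+1)
                (-1) ^+ s * 'C(u - r, s)%:R :> rat
    & forall a : nat -> rat,
        mendelsohn_system n t #|M| (design_index D) a
        <-> koehler_system n t #|M| (design_index D) a].
Proof.
have index_r r : (r <= t)%N -> is_design D r (design_index D r) /\
    (design_index D r * odd_dfact (n - t) = odd_dfact (n - r) * lam)%N.
  move=> le_rt; have [l desl El] := design_le le_rt ht hD.
  by rewrite (design_indexE (leq_trans le_rt ht) desl).
have mendelsohn : mendelsohn_system n t #|M| (design_index D)
    (fun s => (alpha D M s)%:R).
  move=> r /index_r[desr _]; rewrite -natrM -(mendelsohn_count hM desr) natr_sum.
  by apply: eq_bigr => s _; rewrite natrM.
have dfact_neq0 k : (odd_dfact k)%:R != 0 :> rat.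
  by rewrite pnatr_eq0 -lt0n odd_dfact_gt0.
split=> //.
- move=> r le_rt; have [desr Er] := index_r r le_rt.
  have [l0 des0 E0] := design_le (leq0n r) (leq_trans le_rt ht) desr.
  rewrite subn0 (design0_index des0) in E0.
  split; rewrite -mulrA; congr (_ * _); rewrite mulrAC;
    apply: (canRL (mulfK (dfact_neq0 _))); rewrite -!natrM ?Er //.
  by rewrite mulnC -E0 mulnC.
- by apply/mendelsohn_koehler.
- move=> r u le_rt /andP[lt_tu _]; rewrite subSn //.
  by apply: sum_alternating_bin_tail; rewrite ltn_sub2r // (leq_ltn_trans le_rt).
- by move=> a; apply: mendelsohn_koehler.
Qed.
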